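(* Let $n$ be a friend of $10$, and let $q_3$ be the third smallest prime divisor of $n$ (the prime divisors of $n$ being listed without multiplicity in increasing order). Then $$11\leq q_3 < \left\lceil\frac{180\,\omega(n)}{41}\right\rceil\left\{\log\left(\left\lceil\frac{180\,\omega(n)}{41}\right\rceil\right)+2\log\log\left(\left\lceil\frac{180\,\omega(n)}{41}\right\rceil\right)\right\}.$$
   Context: For a positive integer $n$, let $\sigma(n)$ be the sum of the positive divisors of $n$ and let $I(n)=\sigma(n)/n$ be its abundancy index. A friend of $10$ is a positive integer $n\neq 10$ with $I(n)=I(10)=9/5$. $\omega(n)$ denotes the number of distinct prime divisors of $n$, $\lceil\cdot\rceil$ is the ceiling function, and $\log$ is the natural logarithm. The braces in the displayed bound are ordinary grouping brackets (not the fractional part). *)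

(* Defs.v *)
From mathcomp Require Import all_boot all_order all_algebra.
From mathcomp Require Import reals exp.

Set Implicit Arguments.
Unset Strict Implicit.
Unset Printing Implicit Defensive.

Import Order.TTheory GRing.Theory Num.Theory.
Local Open Scope ring_scope.

Definition sigma (n : nat) : nat := (\sum_(d <- divisors n) d)%N.

Definition abundancy (n : nat) : rat := (sigma n)%:R / n%:R.

Definition is_friend (m n : nat) : Prop :=
  [/\ (0 < n)%N, n <> m & abundancy n = abundancy m].

Lemma abundancy10 : abundancy 10 = 9%:R / 5%:R.
Proof. by rewrite /abundancy /sigma unlock. Qed.

Definition omega (n : nat) : nat := size (primes n).

(* [primes n] is strictly increasing, so for [0 < k <= omega n] this is the k-th
   smallest prime divisor of [n]; it is 0 when [n] has fewer than [k] of them. *)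
Definition prime_divisor (k n : nat) : nat := nth 0%N (primes n) k.-1.

(* Main.v *)
(** If [n] is a friend of 10 then [5 * sigma n = 9 * n], so [5 %| n], and [n] is
    odd since proper multiples of 10 have larger abundancy than 10.  Then
    [sigma n] is odd, so the exponents of odd primes in [n] are even.  If
    [3 %| n], then [n] is a multiple of [3^4 * 5^2], or else [3^2] divides it
    exactly, whence [13 = sigma (3^2)] divides it; both [3^4 * 5^2] and
    [3^2 * 5^2 * 13] have abundancy above 9/5.  So the primes of [n] are at
    least 5, 7, 11, and so on.

    As [sigma n / n * \prod_(p | n) (1 - 1 / p) <= 1], the product is at most
    5/9.  It is at least [4/5 * 6/7 * (1 - (omega n - 2) / q3)] by Bernoulli's
    inequality, so [q3 <= 216/41 * (omega n - 2)].  With [N >= 180/41 * omega n],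
    it remains to see that [ln N + 2 ln (ln N) >= 3/2], which holds for
    [N >= 8]. *)

Require Import Defs.
From mathcomp Require Import all_boot all_order all_algebra.
From mathcomp Require Import reals exp.
From mathcomp Require Import zify lra.

Import Order.TTheory GRing.Theory Num.Theory.
Local Open Scope ring_scope.

(** * Multiplicativity and size of the divisor sum *)

Lemma sigmaM m n : (0 < m)%N -> (0 < n)%N -> coprime m n ->
  sigma (m * n) = (sigma m * sigma n)%N.
Proof.
move=> m0 n0 co.
have mn0 : (0 < m * n)%N by rewrite muln_gt0 m0.
rewrite /sigma.
rewrite (perm_big [seq (d * e)%N | d <- divisors m, e <- divisors n]) /=.
  by rewrite big_allpairs_dep big_distrl; apply: eq_bigr => d _; rewrite big_distrr.
apply: uniq_perm; first exact: divisors_uniq.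
  apply: allpairs_uniq; try exact: divisors_uniq.
  move=> [d1 e1] [d2 e2] /allpairsP [[a1 b1] [/= + + [-> ->]]].
  move=> + + /allpairsP [[a2 b2] [/= + + [-> ->]]].
  rewrite -!dvdn_divisors // => da1 db1 da2 db2 eq12.
  (* The gcds of a product with [m] and with [n] recover its two factors, so it arises from one pair
     only. *)
  have gcdl a b : (a %| m -> b %| n -> gcdn m (a * b) = a)%N.
    move=> am bn; rewrite mulnC Gauss_gcdr ?(coprime_dvdr bn) //.
    exact/gcdn_idPr.
  have gcdr a b : (a %| m -> b %| n -> gcdn n (a * b) = b)%N.
    move=> am bn; rewrite Gauss_gcdr ?(coprime_dvdr am) 1?coprime_sym //.
    exact/gcdn_idPr.
  by rewrite -(gcdl a1 b1) // -{2}(gcdr a1 b1) // eq12 gcdl // gcdr.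
move=> d; rewrite -dvdn_divisors //; apply/idP/allpairsP => [dmn|].
  have g0 : (0 < gcdn d m)%N by rewrite gcdn_gt0 m0 orbT.
  exists (gcdn d m, d %/ gcdn d m)%N; rewrite /= -!dvdn_divisors // dvdn_gcdr.
  rewrite mulnC divnK ?dvdn_gcdl //; split=> //.
  have co' : coprime (d %/ gcdn d m) (m %/ gcdn d m).
    rewrite /coprime -(eqn_pmul2r g0) muln_gcdl !divnK ?dvdn_gcdl ?dvdn_gcdr //.
    by rewrite mul1n.
  rewrite -(Gauss_dvdr _ co') -(dvdn_pmul2r g0) mulnAC.
  by rewrite !divnK ?dvdn_gcdl ?dvdn_gcdr.
by case=> -[a b] /=; rewrite -!dvdn_divisors // => -[am bn ->]; exact: dvdn_mul.
Qed.

Lemma sigma_pfactor p k : prime p ->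
  sigma (p ^ k) = (\sum_(i < k.+1) p ^ i)%N.
Proof.
move=> pp; have pk0 : (0 < p ^ k)%N by rewrite expn_gt0 prime_gt0.
rewrite /sigma (perm_big [seq p ^ i | i <- index_iota 0 k.+1]%N).
  by rewrite big_map big_mkord.
apply: uniq_perm; first exact: divisors_uniq.
  rewrite map_inj_uniq ?iota_uniq // => i j /eqP.
  by rewrite eqn_exp2l ?prime_gt1 // => /eqP.
move=> d; rewrite -dvdn_divisors //; apply/(dvdn_pfactor _ _ pp)/mapP => -[i].
  by move=> ik ->; exists i => //; rewrite mem_iota.
by rewrite mem_iota => ik ->; exists i.
Qed.

Lemma sigma_logn p n : prime p -> (0 < n)%N -> exists m,
  n = (p ^ logn p n * m)%N /\ sigma n = (sigma (p ^ logn p n) * sigma m)%N.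
Proof.
move=> pp n0; have [m com en] := pfactor_coprime pp n0.
have m0 : (0 < m)%N by move: n0; rewrite en muln_gt0 => /andP[].
exists m; split; first by rewrite mulnC.
rewrite {1}en mulnC sigmaM ?m0 ?expn_gt0 ?prime_gt0 //.
exact: coprimeXl.
Qed.

(** For [k = logn p n], [sigma (p ^ k)] is a factor of [sigma n] and a sum of [k.+1] odd terms, so
    [k.+1] is odd. *)
Lemma odd_sigma_logn p n : (0 < n)%N -> prime p -> odd p -> odd (sigma n) ->
  ~~ odd (logn p n).
Proof.
move=> n0 pp op; have [m [_ ->]] := sigma_logn p n pp n0.
rewrite oddM => /andP[+ _]; rewrite sigma_pfactor //.
suff -> k : odd (\sum_(i < k.+1) p ^ i) = ~~ odd k by [].
elim: k => [|k IH]; first by rewrite big_ord1.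
by rewrite big_ord_recr oddD IH oddX op /= addbT.
Qed.

(** Multiplying the divisors of [d] by n/d gives divisors of [n], and 1 is not among them unless
    [d = n]. In terms of abundancy, I(d) <= I(n), with a gap of at least 1/n when [d != n]. *)
Lemma leq_sigma_dvd d n : (0 < n)%N -> (d %| n)%N ->
  (sigma d * n + (d != n) * d <= sigma n * d)%N.
Proof.
move=> n0 /dvdnP [k en]; have := n0; rewrite en muln_gt0 => /andP[k0 d0].
suff : (sigma d * k + (d != n) <= sigma n)%N.
  by move/(leq_mul (leqnn d)); rewrite -en; nia.
set s := [seq (e * k)%N | e <- divisors d].
have us : uniq s.
  rewrite map_inj_uniq ?divisors_uniq // => i j /eqP.
  by rewrite eqn_pmul2r // => /eqP.
have ss e : e \in s -> e \in divisors n.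
  case/mapP=> a; rewrite -!dvdn_divisors // => ad ->.
  by rewrite en mulnC dvdn_pmul2l.
have sumle t : uniq t -> {subset t <= divisors n} -> (\sum_(e <- t) e <= sigma n)%N.
  move=> ut st; rewrite /sigma [leqRHS](bigID (mem t)) /=.
  rewrite -[X in (_ <= X + _)%N]big_filter [X in (_ <= X + _)%N](perm_big t) ?leq_addr //.
  apply: uniq_perm => //; first by rewrite filter_uniq ?divisors_uniq.
  by move=> e; rewrite mem_filter; case et : (e \in t) => //=; rewrite st.
have -> : (sigma d * k = \sum_(e <- s) e)%N by rewrite big_map /sigma big_distrl.
case: eqP => [_|/eqP dn]; first by rewrite addn0 sumle.
rewrite addn1; have := sumle (1%N :: s); rewrite big_cons add1n; apply.
  rewrite /= us andbT; apply/mapP => -[a _ /esym/eqP].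
  rewrite muln_eq1 => /andP[_ /eqP k1].
  by move: dn; rewrite en k1 mul1n eqxx.
by move=> e; rewrite inE => /orP[/eqP->|/ss//]; exact: divisor1.
Qed.

(** Multiplicativity reduces this to prime powers, where [sigma (p ^ k) * p.-1 = p ^ k.+1 - 1]. *)
Lemma sigma_prod_primes n : (0 < n)%N ->
  (sigma n * \prod_(p <- primes n) p.-1 <= n * \prod_(p <- primes n) p)%N.
Proof.
move=> n0; have en : (n = \prod_(p <- primes n) p ^ logn p n)%N.
  by rewrite {1}[n]prod_prime_decomp // prime_decompE big_map.
(* Expanding [n] only outside [primes n] lets the induction run over any list of distinct primes,
   with the exponents [logn p n] fixed. *)
rewrite {1 3}en.
have := primes_uniq n; have := all_prime_primes n.
elim: (primes n) => [|p s IH] /=; first by rewrite !big_nil /sigma unlock.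
case/andP=> pp aps /andP[ps us]; rewrite !big_cons.
have prod0 : (0 < \prod_(q <- s) q ^ logn q n)%N by rewrite prodn_gt0.
rewrite sigmaM ?prod0 ?expn_gt0 ?prime_gt0 //; last first.
  rewrite big_seq; elim/big_ind: _ => [|a b ca cb|q qs]; first exact: coprimen1.
    by rewrite coprimeMr ca.
  apply/coprimeXl/coprimeXr; rewrite prime_coprime // dvdn_prime2 ?pp ?(allP aps) //.
  by apply: contraNneq ps => ->.
have le_p : (sigma (p ^ logn p n) * p.-1 <= p ^ logn p n * p)%N.
  rewrite sigma_pfactor // mulnC -(predn_exp p (logn p n).+1) -expnSr; exact: leq_pred.
by rewrite mulnACA [leqRHS]mulnACA leq_mul // IH.
Qed.

(** * Divisibility properties of a friend of 10 *)

Lemma friend10E n : is_friend 10 n -> (5 * sigma n = 9 * n)%N.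
Proof.
case=> n0 _; rewrite abundancy10 /abundancy => /eqP.
rewrite eqr_div ?pnatr_eq0 -?lt0n // -!natrM eqr_nat => /eqP.
by rewrite mulnC.
Qed.

Lemma friend10_dvd5 n : is_friend 10 n -> (5 %| n)%N.
Proof.
move/friend10E=> e; rewrite -(@Gauss_dvdr 5 9 n) //.
by rewrite -e dvdn_mulr.
Qed.

Lemma friend10_odd n : is_friend 10 n -> odd n.
Proof.
move=> fn; have [n0 n10 _] := fn; rewrite -[odd n]negbK -dvdn2; apply/negP => n2.
have d10 : (10 %| n)%N by rewrite (@Gauss_dvd 2 5) // n2 friend10_dvd5.
(* The extra term for [10 != n] gives [18 * n + 10 <= 10 * sigma n = 18 * n]. *)
have := leq_sigma_dvd _ _ n0 d10; have -> : (10 != n)%N by apply/eqP => /esym.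
have -> : sigma 10 = 18%N by rewrite /sigma unlock.
by have := friend10E _ fn; lia.
Qed.

Lemma friend10_logn p n : is_friend 10 n -> prime p -> (p %| n)%N ->
  (2 <= logn p n)%N /\ ~~ odd (logn p n).
Proof.
move=> fn pp pn; have [n0 _ _] := fn.
have on := friend10_odd _ fn.
have op : odd p by exact: dvdn_odd pn on.
have ev : ~~ odd (logn p n).
  apply: odd_sigma_logn => //; have := congr1 odd (friend10E _ fn).
  by rewrite !oddM /= on.
have : (0 < logn p n)%N by rewrite logn_gt0 mem_primes pp n0.
by case: (logn p n) ev => [|[]].
Qed.

Lemma friend10_sigma_dvd d n : is_friend 10 n -> (d %| n)%N ->
  (5 * sigma d <= 9 * d)%N.
Proof.
move=> fn dn; have [n0 _ _] := fn.
have := leq_sigma_dvd _ _ n0 dn; have := friend10E _ fn.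
move=> e /(leq_trans (leq_addr _ _)) h.
by rewrite -(leq_pmul2r n0); nia.
Qed.

Lemma friend10_ndvd3 n : is_friend 10 n -> ~~ (3 %| n)%N.
Proof.
move=> fn; apply/negP => d3; have [n0 _ _] := fn; have d5 := friend10_dvd5 _ fn.
have [l3 ev3] := friend10_logn 3 _ fn isT d3.
have [l5 _] := friend10_logn 5 _ fn isT d5.
have d25 : (5 ^ 2 %| n)%N by rewrite pfactor_dvdn.
have s25 : sigma (5 ^ 2) = 31%N by rewrite sigma_pfactor // !big_ord_recr big_ord0.
have [l34|] := leqP 4 (logn 3 n).
  have d81 : (3 ^ 4 %| n)%N by rewrite pfactor_dvdn.
  have s81 : sigma (3 ^ 4) = 121%N by rewrite sigma_pfactor // !big_ord_recr big_ord0.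
  (* Contradiction: [5 * 121 * 31 = 18755] exceeds [9 * 2025 = 18225]. *)
  have : (3 ^ 4 * 5 ^ 2 %| n)%N by rewrite Gauss_dvd // d81.
  by move/(friend10_sigma_dvd _ _ fn); rewrite sigmaM // s25 s81.
rewrite ltnS => l33; have {l3 ev3 l33} l32 : logn 3 n = 2%N.
  by case: (logn 3 n) l3 ev3 l33 => [|[|[|[|]]]].
have d9 : (3 ^ 2 %| n)%N by rewrite pfactor_dvdn // l32.
have s9 : sigma (3 ^ 2) = 13%N by rewrite sigma_pfactor // !big_ord_recr big_ord0.
have d13 : (13 %| n)%N.
  have [m [_]] := sigma_logn 3 n isT n0; rewrite l32 s9 => sn.
  by rewrite -(@Gauss_dvdr 13 9) // -friend10E // sn dvdn_mull ?dvdn_mulr.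
have s13 : sigma 13 = 14%N by rewrite -(expn1 13) sigma_pfactor // !big_ord_recr big_ord0.
(* Contradiction: [5 * 13 * 31 * 14 = 28210] exceeds [9 * 2925 = 26325]. *)
have : (3 ^ 2 * 5 ^ 2 * 13 %| n)%N by rewrite Gauss_dvd // d13 Gauss_dvd // d9 d25.
by move/(friend10_sigma_dvd _ _ fn); rewrite sigmaM // s13 sigmaM // s25 s9.
Qed.

Lemma friend10_prime_ge5 n p : is_friend 10 n -> p \in primes n -> (5 <= p)%N.
Proof.
move=> fn; rewrite mem_primes => /and3P[pp _ pn].
have op : odd p by exact: dvdn_odd pn (friend10_odd _ fn).
have p3 : p <> 3%N by move=> p3; move: (friend10_ndvd3 _ fn); rewrite -p3 pn.
have := prime_gt1 pp; clear -op p3.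
by case: p op p3 => [|[|[|[|[]]]]].
Qed.

(** * Bounding the third prime divisor linearly in the number of primes *)

(* Bernoulli's inequality, cleared of denominators. *)
Lemma prod_pred_ge (q : nat) (s : seq nat) : (0 < q)%N -> all (leq q) s ->
  (q * \prod_(p <- s) p <= q * \prod_(p <- s) p.-1 + size s * \prod_(p <- s) p)%N.
Proof.
move=> q0; elim: s => [|p s IH] /=; first by rewrite !big_nil addn0.
case/andP=> qp /IH; rewrite !big_cons.
have : (\prod_(i <- s) i.-1 <= \prod_(i <- s) i)%N.
  by apply: leq_prod => i _; exact: leq_pred.
move: (\prod_(i <- s) i.-1)%N (\prod_(i <- s) i)%N => a b ab h.
have {2}-> : p = p.-1.+1 by rewrite prednK // (leq_trans q0).
have : (q <= p.-1.+1)%N by rewrite prednK // (leq_trans q0).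
have -> : p = p.-1.+1 by rewrite prednK // (leq_trans q0).
rewrite -!pred_Sn; move: p.-1 => r qr.
by have := leq_mul (leqnn r) h; nia.
Qed.

(** Since 1 - 1/x grows with x, (1 - 1/a)(1 - 1/b) is at least 4/5 * 6/7 = 24/35. *)
Lemma leq_mul_pred57 a b : (5 <= a)%N -> (7 <= b)%N ->
  (24 * (a * b) <= 35 * (a.-1 * b.-1))%N.
Proof.
move=> a5 b7; have a45 : (4 * a <= 5 * a.-1)%N by lia.
have b67 : (6 * b <= 7 * b.-1)%N by lia.
by have := leq_mul a45 b67; lia.
Qed.

(** The list [s] consists of the primes beyond the third, so [(size s).+1] is [omega n - 2]. *)
Lemma friend10_primes n : is_friend 10 n -> exists q (s : seq nat),
  [/\ prime_divisor 3 n = q, omega n = (size s).+3, (11 <= q)%N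
    & (41 * q <= 216 * (size s).+1)%N].
Proof.
move=> fn; have [n0 _ _] := fn.
have prod59 : (9 * \prod_(p <- primes n) p.-1 <= 5 * \prod_(p <- primes n) p)%N.
  rewrite -(leq_pmul2l n0) !mulnA ![(n * _)%N]mulnC -(friend10E _ fn).
  by rewrite -!mulnA leq_mul2l sigma_prod_primes // orbT.
have ge5 : all (leq 5) (primes n).
  by apply/allP => p; exact: friend10_prime_ge5.
rewrite /prime_divisor /omega.
move: (sorted_primes n) (all_prime_primes n) ge5 prod59.
case: (primes n) => [|p1 [|p2 [|q s]]] /=.
(* With fewer than three primes the product of the 1 - 1/p is 1, at least 4/5, or at least 24/35,
   always above 5/9. *)
- by rewrite !big_nil.
- by rewrite !big_cons !big_nil andbT; lia.
- rewrite !big_cons !big_nil !andbT => lt12 /andP[pp1 pp2] /andP[p1_ge5 _].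
  have p2_ne6 : p2 <> 6%N by move=> e; rewrite e in pp2.
  move=> prod59; exfalso.
  by have := leq_mul_pred57 p1 p2; nia.
rewrite !(@big_cons _ _ _ _ p1) !(@big_cons _ _ _ _ p2).
case/and3P=> lt12 lt2q qs /and4P[pp1 pp2 pq _] /and4P[p1_ge5 _ _ _] prod59.
have p2_ge7 : (7 <= p2)%N by have : p2 <> 6%N by [move=> e; rewrite e in pp2]; lia.
have q_ge11 : (11 <= q)%N.
  have ne k : ~~ prime k -> q <> k by move=> + e; rewrite -e pq.
  by have := ne 8%N isT; have := ne 9%N isT; have := ne 10%N isT; lia.
exists q, s; split=> //.
have q_le : all (leq q) (q :: s).
  rewrite /= leqnn; apply: (sub_all _ (order_path_min ltn_trans qs)).
  by move=> p /ltnW.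
have := prod_pred_ge q (q :: s) (ltnW (leq_trans _ q_ge11)) q_le.
have prod0 : (0 < \prod_(p <- q :: s) p)%N.
  rewrite big_seq prodn_cond_gt0 // => p /(allP q_le).
  by apply: leq_trans; lia.
move: prod59 prod0; set B := \prod_(p <- _) p.-1; set A := \prod_(p <- _) p.
move=> prod59 A0 /(_ isT) bern.
have le12 := leq_mul_pred57 p1 p2 p1_ge5 p2_ge7.
(* Here 175/216 = (5/9) / (24/35); the 41 of the conclusion is 216 - 175. *)
have le_BA : (216 * B <= 175 * A)%N.
  have p12 : (0 < p1 * p2)%N by rewrite muln_gt0; lia.
  by rewrite -(leq_pmul2l p12); have := leq_mul le12 (leqnn B); nia.
rewrite -(leq_pmul2r A0).
by have := leq_mul (leqnn q) le_BA; move: bern; rewrite /=; nia.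
Qed.

(** The bound ln(1 + x) <= x at x = -1/2 gives ln 2 >= 1/2, hence ln 8 >= 3/2. *)
Lemma ln_ge3half (R : realType) (x : R) : 8 <= x -> 3 / 2 <= ln x.
Proof.
move=> x8; have h2 : 1 / 2 <= ln (2 : R).
  have := @le_ln1Dx R (- (1 / 2)); have -> : 1 + - (1 / 2) = 2^-1 :> R by lra.
  by rewrite lnV ?posrE // => /(_ ltac:(lra)); lra.
have : ln (2 ^+ 3 : R) <= ln x by rewrite ler_ln ?posrE //; lra.
by rewrite lnXn //; lra.
Qed.

Theorem theorem1p2 (R : realType) (n : nat) (n_friend : is_friend 10 n) :
  let q3 := prime_divisor 3 n in
  let N : R := (Num.ceil (180%:R * (omega n)%:R / 41%:R : R))%:~R in
  (11 <= q3)%N /\ q3%:R < N * (ln N + 2%:R * ln (ln N)).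
Proof.
move=> q3 N; have [q [s [eq3 om q11 qs]]] := friend10_primes n n_friend.
rewrite /q3 eq3; split=> //.
have N_ge : 180 * ((size s)%:R + 3) / 41 <= N.
  by apply: (le_trans _ (ceil_ge _));
  rewrite om -(addn3 (size s)) (natrD _ (size s)).
have s0 : 0 <= (size s)%:R :> R by [].
have {}qs : 41 * q%:R <= 216 * ((size s)%:R + 1) :> R.
  by rewrite -[1]/(1%:R) -!natrD -!natrM ler_nat addn1.
(* As [omega n] is at least 3, [N] is at least 540/41 > 13. *)
have lnN : 3 / 2 <= ln N by apply: ln_ge3half; lra.
have lnlnN : 0 <= ln (ln N) by apply: ln_ge0; lra.
(* The factor 3/2 turns 180/41 into 270/41, which exceeds 216/41. *)
apply: (@lt_le_trans _ _ (N * (3 / 2))); first by lra.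
by rewrite ler_pM2l; lra.
Qed.
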